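(* Let $(A,\le,0,1)$ be a bounded MLUB-complete poset, $(T,R)$ a time frame with $R$ reflexive, and $P,F,H,G$ the tense operators induced by $(T,R)$. Then for every $q\in A^T$: $q\le\varphi(P(q))$, $q\le\varphi(F(q))$, $\varphi(H(q))\le q$, and $\varphi(G(q))\le q$.
   Context: For a poset and $X\subseteq A$: $L(X)$, $U(X)$ the sets of lower/upper bounds, $\operatorname{Max}X,\operatorname{Min}X$ the maximal/minimal elements. MLUB-complete: for every nonempty $M$, every upper bound of $M$ lies above a minimal upper bound and every lower bound below a maximal lower bound. $\mathcal P_+(X)$ = nonempty subsets. $A^T$ is ordered componentwise; for subsets $X,Y$ (singletons identified with their elements), $X\le Y$ iff $x\le y$ for all $x\in X,y\in Y$. A time frame is $(T,R)$, $T\ne\emptyset$, $R\subseteq T^2$. The induced tense operators $P,F,H,G:\mathcal P_+(A^T)\to(\mathcal P_+A)^T$ are $P(B)(s)=\operatorname{Min}U(\{p(t)\mid p\in B,tRs\})$, $F(B)(s)=\operatorname{Min}U(\{p(t)\mid p\in B,sRt\})$, $H(B)(s)=\operatorname{Max}L(\{p(t)\mid p\in B,tRs\})$, $G(B)(s)=\operatorname{Max}L(\{p(t)\mid p\in B,sRt\})$; $P(q)$ means $P(\{q\})$ etc. The transformation function $\varphi:(\mathcal P_+A)^T\to\mathcal P_+(A^T)$ is $\varphi(Z)=\{p\in A^T\mid p(t)\in Z(t)\text{ for all }t\in T\}$. *)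

(* Defs.v *)
From mathcomp Require Import all_boot all_order.
From mathcomp Require Import boolp classical_sets.

Set Implicit Arguments.
Unset Strict Implicit.
Unset Printing Implicit Defensive.

Import Order.TTheory.
Local Open Scope order_scope.
Local Open Scope classical_set_scope.

Record nset (X : Type) : Type := NSet {
  nset_val :> set X;
  nset_neq0 : nset_val !=set0
}.

Definition nset1 (X : Type) (x : X) : nset X :=
  NSet (ex_intro (fun y => [set x] y) x (erefl x)).

Definition Max (d : Order.disp_t) (A : porderType d) (X : set A) : set A :=
  [set x | X x /\ forall y, X y -> x <= y -> y = x].

Definition Min (d : Order.disp_t) (A : porderType d) (X : set A) : set A :=
  [set x | X x /\ forall y, X y -> y <= x -> y = x].

Definition MLUB_complete (d : Order.disp_t) (A : porderType d) : Prop :=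
  forall M : set A, M !=set0 ->
    (forall u, ubound M u -> exists2 m, Min (ubound M) m & m <= u) /\
    (forall l, lbound M l -> exists2 m, Max (lbound M) m & l <= m).

(* For [M] empty, MLUB-completeness says nothing and the bounds of the poset
   are used: [Min (ubound set0) = [set \bot]], [Max (lbound set0) = [set \top]]. *)
Lemma Min_ubound_neq0 (d : Order.disp_t) (A : tbPOrderType d) (M : set A) :
  MLUB_complete A -> Min (ubound M) !=set0.
Proof.
move=> cA; have [->|/set0P M0] := eqVneq M set0.
  exists \bot; split=> [x []|y _ y0]; by apply/eqP; rewrite eq_le y0 le0x.
have [m mM _] := (cA M M0).1 \top (fun x _ => lex1 x).
by exists m.
Qed.

Lemma Max_lbound_neq0 (d : Order.disp_t) (A : tbPOrderType d) (M : set A) :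
  MLUB_complete A -> Max (lbound M) !=set0.
Proof.
move=> cA; have [->|/set0P M0] := eqVneq M set0.
  exists \top; split=> [x []|y _ y1]; by apply/eqP; rewrite eq_le y1 lex1.
have [m mM _] := (cA M M0).2 \bot (fun x _ => le0x x).
by exists m.
Qed.

Section Tense.
Context {d : Order.disp_t} {A : tbPOrderType d} (cA : MLUB_complete A).
Context {T : Type} (R : T -> T -> Prop).

Definition past_values (B : set (T -> A)) (s : T) : set A :=
  [set a | exists p t, [/\ B p, R t s & a = p t]].

Definition future_values (B : set (T -> A)) (s : T) : set A :=
  [set a | exists p t, [/\ B p, R s t & a = p t]].

Definition tenseP (B : nset (T -> A)) : T -> nset A :=
  fun s => NSet (Min_ubound_neq0 (past_values B s) cA).

Definition tenseF (B : nset (T -> A)) : T -> nset A :=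
  fun s => NSet (Min_ubound_neq0 (future_values B s) cA).

Definition tenseH (B : nset (T -> A)) : T -> nset A :=
  fun s => NSet (Max_lbound_neq0 (past_values B s) cA).

Definition tenseG (B : nset (T -> A)) : T -> nset A :=
  fun s => NSet (Max_lbound_neq0 (future_values B s) cA).

End Tense.

Lemma transformation_neq0 (A T : Type) (Z : T -> nset A) :
  [set p : T -> A | forall t, nset_val (Z t) (p t)] !=set0.
Proof.
have [p pZ] := choice (fun t => nset_neq0 (Z t)).
by exists p.
Qed.

Definition transformation (A T : Type) (Z : T -> nset A) : nset (T -> A) :=
  NSet (transformation_neq0 Z).

(* On [T -> A] the canonical [<=] is the componentwise order (see [lefP]). *)
Definition le_set (d : Order.disp_t) (B : porderType d) (X Y : set B) : Prop :=
  forall x y, X x -> Y y -> x <= y.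

(* Main.v *)
Require Import Defs.
From mathcomp Require Import all_boot all_order.
From mathcomp Require Import boolp classical_sets.

Theorem theorem3p9 (d : Order.disp_t) (A : tbPOrderType d)
    (cA : MLUB_complete A) (T : Type) (T_nonempty : inhabited T)
    (R : T -> T -> Prop) (R_refl : forall t : T, R t t) :
  forall q : T -> A,
    [/\ le_set (nset1 q) (transformation (tenseP cA R (nset1 q))),
        le_set (nset1 q) (transformation (tenseF cA R (nset1 q))),
        le_set (transformation (tenseH cA R (nset1 q))) (nset1 q) &
        le_set (transformation (tenseG cA R (nset1 q))) (nset1 q)].
Proof.
(* Work pointwise: a member of the transformed set takes at [t] a value bounding all values of [q]
   at times related to [t], from above for [tenseP] and [tenseF], from below for [tenseH] and
   [tenseG]. *)
by move=> q; split=> f g /=; [move=> -> gZ|move=> -> gZ|move=> fZ ->|move=> fZ ->];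
  apply/lefP => t; [case: (gZ t)|case: (gZ t)|case: (fZ t)|case: (fZ t)];
  (* By [R_refl], [t] lies in its own past and future, so [q t] is itself one of the values that
     [bnd] bounds. *)
  move=> bnd _; apply: bnd; exists q, t; split.
Qed.
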